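(* Let $p$ be an odd prime and let $x$, $q$ be indeterminates. Then $$\sum_{k=0}^{p-1}\frac{(q;q^2)_k^2}{(q^2;q^2)_k^2}\, x^k \equiv \sum_{k=0}^{\frac{p-1}{2}}{\frac{p-1}{2}\brack k}_{q^2}^2 q^{-pk+k^2} (-x)^k (x;q^2)_{\frac{p-1}{2}-k}\pmod{[p]^2}.$$
   Context: $q$ is an indeterminate. $(a;q)_0=1$ and $(a;q)_n=(1-a)(1-aq)\cdots(1-aq^{n-1})$ for $n\ge 1$; so $(a;q^m)_n=\prod_{j=0}^{n-1}(1-aq^{mj})$. The $q$-binomial coefficient is ${n\brack k}_q=\frac{(q^{n-k+1};q)_k}{(q;q)_k}$ if $0\le k\le n$ and $0$ otherwise; ${n\brack k}_{q^m}$ is obtained by replacing $q$ by $q^m$. $[p]=1+q+\cdots+q^{p-1}$, which is irreducible in $\mathbb{Q}[q]$ for $p$ prime. For rational functions $A(q),B(q)\in\mathbb{Q}(q)$ whose denominators are relatively prime to $[p]$, $A\equiv B\pmod{[p]^r}$ means that $A-B$ can be written as a fraction whose numerator is divisible by $[p]^r$ in $\mathbb{Q}[q]$ and whose denominator is relatively prime to $[p]$ (negative powers of $q$ are allowed). For polynomials in $x$ with such coefficients, congruence modulo $[p]^r$ means congruence of the coefficients of $x^k$ modulo $[p]^r$ for every $k$. *)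

(* Defs.v *)
From HB Require Import structures.
From mathcomp Require Import all_boot all_order all_algebra.

Set Implicit Arguments.
Unset Strict Implicit.
Unset Printing Implicit Defensive.

Import GRing.Theory.
Local Open Scope ring_scope.

(* The field Q(q): the indeterminate q is 'X of {poly rat}, so that the letter *)
(* 'X stays available for x in {poly Qq} = Q(q)[x].                            *)
Notation Qq := {fraction {poly rat}}.

Definition toQq (P : {poly rat}) : Qq := tofrac P.
Definition qvar : Qq := toQq 'X.

(* (a; q)_n; the base q is an argument, so (a; q^m)_n is qpoch a (q ^+ m) n. *)
Definition qpoch (R : comNzRingType) (a q : R) (n : nat) : R :=
  \prod_(j < n) (1 - a * q ^+ j).

(* The base q is again an argument. Division is that of the field F, hence     *)
(* this is only meaningful when (q; q)_k != 0, e.g. when q is a power q^m,     *)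
(* m > 0, of an indeterminate.                                                 *)
Definition qbinom (F : fieldType) (q : F) (n k : nat) : F :=
  if (k <= n)%N then qpoch (q ^+ (n - k + 1)) q k / qpoch q q k else 0.

Definition qint (p : nat) : {poly rat} := \sum_(i < p) 'X^i.

Definition den_coprime (P : {poly rat}) (A : Qq) : Prop :=
  exists N D : {poly rat}, [/\ D != 0, coprimep D P & A = toQq N / toQq D].

(* A = B mod P^r in Q(q). This presupposes that both A and B have            *)
(* denominators coprime to P; that is made part of the relation.               *)
Definition qcong (P : {poly rat}) (r : nat) (A B : Qq) : Prop :=
  [/\ den_coprime P A, den_coprime P B &
      exists N D : {poly rat},
        [/\ D != 0, coprimep D P, P ^+ r %| N & A - B = toQq N / toQq D]].

Definition qcong_poly (P : {poly rat}) (r : nat) (A B : {poly Qq}) : Prop :=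
  forall k : nat, qcong P r A`_k B`_k.

(* Main.v *)
Require Import Defs.
From mathcomp Require Import all_boot all_order all_algebra.
From mathcomp Require Import ring zify.
Import GRing.Theory.
Local Open Scope ring_scope.

(** Put Q = q^2 and n = (p - 1) / 2, so that q^p = q Q^n. Both sides are compared
    coefficientwise, through the intermediate quantity
      B_m = (Q^-n; Q)_m (Q^(n+1); Q)_m / (Q; Q)_m^2.

    The coefficient of x^m on the right-hand side is exactly B_m
    ([coef_q_legendre]); this is a q-analogue of the two classical expressions
    of the shifted Legendre polynomial,
      sum_k 'C(n, k) 'C(n + k, k) (-x)^k = sum_k 'C(n, k)^2 (-x)^k (1 - x)^(n - k),
    and, as in the classical case, comparing coefficients reduces it to
    Vandermonde's convolution. The latter is read off the factorization
      (x; Q)_(n+m) = (x; Q)_n (x Q^n; Q)_m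
    once the coefficients of (x; Q)_n are known ([coef_qpoch], the finite
    q-binomial theorem).

    On the left-hand side, the coefficient of x^m for m < p and B_m are products
    over j < m of quotients with the same denominator (1 - Q^(j+1))^2. With
    i = 2 j + 1 and a = q^p, the numerators are (1 - q^i)^2 and
    (1 - q^i / a) (1 - q^i a), and
      (1 - q^i)^2 - (1 - q^i / a) (1 - q^i a) = (q^i / a) (1 - a)^2.
    Since 1 - a = (1 - q) [p], corresponding factors are congruent modulo [p]^2
    ([qcong_factor]), and congruences between fractions with denominator coprime
    to [p] can be multiplied ([qcong_prod]). The denominators are admissible
    because 1 - q^k is coprime to [p] when k is coprime to p. For m >= p, B_m
    contains the factor 1 - Q^-n Q^n = 0. *)

(** * Shifted factorials and q-binomial coefficients *)

Lemma qpochSr (R : comNzRingType) (a q : R) n :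
  qpoch a q n.+1 = qpoch a q n * (1 - a * q ^+ n).
Proof. by rewrite /qpoch big_ord_recr. Qed.

Lemma qpochD (R : comNzRingType) (a q : R) m n :
  qpoch a q (m + n) = qpoch a q m * qpoch (a * q ^+ m) q n.
Proof.
elim: n => [|n IHn]; first by rewrite addn0 /qpoch big_ord0 mulr1.
by rewrite addnS !qpochSr IHn exprD !mulrA.
Qed.

Lemma qpochSl (R : comNzRingType) (a q : R) n :
  qpoch a q n.+1 = (1 - a) * qpoch (a * q) q n.
Proof. by rewrite -add1n qpochD qpochSr /qpoch big_ord0 mul1r expr1 mulr1. Qed.

Section Gauss.
Variables (F : fieldType) (Q : F).
Hypothesis Q_aperiodic : forall i, (0 < i)%N -> Q ^+ i != 1.

Lemma qfact_neq0 n : qpoch Q Q n != 0.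
Proof.
apply/prodf_neq0 => i _; rewrite -exprS subr_eq0 eq_sym.
exact: Q_aperiodic.
Qed.

Lemma qpoch_qfact m k :
  qpoch (Q ^+ (m + 1)) Q k = qpoch Q Q (m + k) / qpoch Q Q m.
Proof.
by rewrite qpochD -exprS addn1 mulrC mulKf ?qfact_neq0.
Qed.

Lemma qbinom_qfact n k : (k <= n)%N ->
  qbinom Q n k = qpoch Q Q n / (qpoch Q Q k * qpoch Q Q (n - k)).
Proof.
move=> le_kn; rewrite /qbinom le_kn qpoch_qfact subnK //.
by rewrite invfM mulrAC mulrA.
Qed.

Lemma qbinom_gt n k : (n < k)%N -> qbinom Q n k = 0.
Proof. by rewrite /qbinom ltnNge => /negbTE ->. Qed.

Lemma qbinom0 n : qbinom Q n 0 = 1.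
Proof. by rewrite /qbinom /qpoch !big_ord0 divr1. Qed.

Lemma qbinomn n : qbinom Q n n = 1.
Proof.
by rewrite qbinom_qfact // subnn [qpoch _ _ 0]big_ord0 mulr1 divff ?qfact_neq0.
Qed.

(** The usual form has Q^(n-k) in front of the last term; multiplying by Q^k
    removes the subtraction, so that the rule holds for all n and k. *)
Lemma qbinom_pascal n k :
  Q ^+ k * qbinom Q n.+1 k.+1 = Q ^+ k * qbinom Q n k.+1 + Q ^+ n * qbinom Q n k.
Proof.
case: (ltngtP k n) => [lt_kn|lt_nk|->]; last 2 first.
- rewrite (@qbinom_gt n.+1 k.+1 lt_nk) (@qbinom_gt n k.+1 (leqW lt_nk)).
  by rewrite (@qbinom_gt n k lt_nk) !mulr0 addr0.
- by rewrite !qbinomn qbinom_gt // mulr0 add0r.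
have [d ->] : exists d, n = (k + d.+1)%N by exists (n - k).-1; lia.
rewrite !qbinom_qfact; try lia.
have -> : ((k + d.+1).+1 - k.+1 = d.+1)%N by lia.
have -> : ((k + d.+1) - k.+1 = d)%N by lia.
have -> : ((k + d.+1) - k = d.+1)%N by lia.
have := qfact_neq0 k.+1; have := qfact_neq0 d.+1.
rewrite !qpochSr -!exprS !mulf_eq0 !negb_or => /andP[d0 d1] /andP[k0 k1].
move: (qpoch Q Q _) d0 k0 => /= fd; move: (qpoch Q Q k) (qpoch Q Q _) => fk fn d0 k0.
rewrite !exprS exprD exprS in d1 k1 *.
by field; rewrite d0 k0 d1 k1.
Qed.

Lemma qbinom_trinomial n m k : (k <= m)%N -> (m <= n)%N ->
  qbinom Q n k * qbinom Q (n - k) (m - k) = qbinom Q n m * qbinom Q m k.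
Proof.
move=> le_km le_mn; rewrite !qbinom_qfact ?leq_sub2r ?(leq_trans le_km) //.
have -> : (n - k - (m - k) = n - m)%N by lia.
by field; rewrite !qfact_neq0.
Qed.

(** The finite q-binomial theorem. The scaling by c makes it apply to both factors
    of (x; Q)_(n+m) = (x; Q)_n (x Q^n; Q)_m. *)
Lemma coef_qpoch c n k :
  (qpoch (c *: 'X) Q%:P n)`_k
    = c ^+ k * ((-1) ^+ k * Q ^+ 'C(k, 2) * qbinom Q n k).
Proof.
elim: n k => [|n IHn] k.
  rewrite /qpoch big_ord0 coef1; case: k => [|k].
    by rewrite qbinom0 bin0n !mulr1.
  by rewrite qbinom_gt // !mulr0.
rewrite qpochSr mulrBr mulr1 coefB -scalerAl -!rmorphXn /= -scalerAr mulrA.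
rewrite coefZ coefMC coefMX; case: k => [|k] /=.
  by rewrite IHn !qbinom0 mul0r mulr0 subr0.
rewrite !IHn binS bin1 exprD !exprS.
transitivity (c * c ^+ k * (- 1 * (-1) ^+ k) * Q ^+ 'C(k, 2) *
    (Q ^+ k * qbinom Q n.+1 k.+1)); last by ring.
by rewrite qbinom_pascal; ring.
Qed.

Lemma coef_qpochX n k :
  (qpoch 'X Q%:P n)`_k = (-1) ^+ k * Q ^+ 'C(k, 2) * qbinom Q n k.
Proof. by have := coef_qpoch 1 n k; rewrite scale1r expr1n mul1r. Qed.

(** Compare the coefficients of x^m in (x; Q)_(n+m) = (x; Q)_n (x Q^n; Q)_m. The
    exponents 'C(k, 2) are kept as this comparison produces them: in this form
    the identity is the one needed in [coef_q_legendre]. *)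
Lemma q_vandermonde n m :
  \sum_(k < m.+1) Q ^+ ('C(k, 2) + 'C(m - k, 2) + n * (m - k))
      * qbinom Q n k * qbinom Q m k
    = Q ^+ 'C(m, 2) * qbinom Q (n + m) m.
Proof.
have qbinom_sub k : (k <= m)%N -> qbinom Q m (m - k) = qbinom Q m k.
  move=> le_km; rewrite !qbinom_qfact ?leq_subr // subKn //.
  by rewrite [_ * qpoch _ _ k]mulrC.
have shiftX : 'X * Q%:P ^+ n = Q ^+ n *: 'X :> {poly F}.
  by rewrite mulrC -rmorphXn /= mul_polyC.
have /(congr1 (fun p : {poly F} => p`_m)) := qpochD _ 'X Q%:P n m.
rewrite shiftX coefM coef_qpochX => eq_m.
apply: (can_inj (signrMK m)).
rewrite -[RHS]/(_ ^+ m * (_ * _)) [RHS]mulrA eq_m mulr_sumr.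
apply: eq_bigr => -[k lt_km] _ /=; rewrite coef_qpochX coef_qpoch qbinom_sub //.
rewrite -{1}(subnKC (lt_km : (k <= m)%N)) !exprD exprM; ring.
Qed.

(** Extract - Q^(j-n) from each factor 1 - Q^(j-n), which leaves 1 - Q^(n-j). *)
Lemma qpoch_invX n m : Q != 0 -> (m <= n)%N ->
  qpoch (Q ^- n) Q m
    = (-1) ^+ m * Q ^+ 'C(m, 2) / Q ^+ (n * m) * qpoch (Q ^+ (n - m + 1)) Q m.
Proof.
move=> Q0; elim: m => [|m IHm] lt_mn.
  by rewrite /qpoch !big_ord0 muln0 bin0n !mulr1 divr1.
rewrite qpochSr IHm 1?ltnW // qpochSl.
have -> : (n - m.+1 + 1 = n - m)%N by lia.
have [d ->] : exists d, n = (m + d)%N by exists (n - m)%N; lia.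
rewrite -exprSr addn1 addKn binS bin1 mulnS !exprD exprS.
by rewrite [(-1) ^+ _.+1]exprS; field; rewrite !expf_neq0.
Qed.

Lemma qpoch_invX_gt n m : Q != 0 -> (n < m)%N -> qpoch (Q ^- n) Q m = 0.
Proof.
move=> Q0 lt_nm; rewrite /qpoch (bigD1 (Ordinal lt_nm)) //=.
by rewrite mulVf ?expf_neq0 // subrr mul0r.
Qed.

(** By [qbinom_trinomial] the k-th term on the left contributes, up to factors
    depending on n and m only, the k-th term of [q_vandermonde]; both sides vanish
    for m > n. *)
Lemma coef_q_legendre n m : Q != 0 ->
  (\sum_(0 <= k < n.+1) (qbinom Q n k ^+ 2 * (Q ^+ 'C(k, 2) / Q ^+ (n * k)))
      *: ((- 'X) ^+ k * qpoch 'X Q%:P (n - k)))`_m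
    = qpoch (Q ^- n) Q m * qpoch (Q ^+ n.+1) Q m / qpoch Q Q m ^+ 2.
Proof.
move=> Q0; have coefE k : (0 <= k < n.+1)%N ->
    ((qbinom Q n k ^+ 2 * (Q ^+ 'C(k, 2) / Q ^+ (n * k)))
      *: ((- 'X) ^+ k * qpoch 'X Q%:P (n - k)))`_m
    = if (k <= m)%N then
        qbinom Q n k ^+ 2 * (Q ^+ 'C(k, 2) / Q ^+ (n * k)) * (-1) ^+ m
        * Q ^+ 'C(m - k, 2) * qbinom Q (n - k) (m - k) else 0.
  move=> _; have -> : (- 'X : {poly F}) ^+ k = (-1) ^+ k *: 'X^k.
    by rewrite -exprZn scaleN1r.
  rewrite -scalerAl !coefZ coefXnM ltnNge.
  case: leqP => [le_km|] /=; last by rewrite !mulr0.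
  have -> : (-1) ^+ m = (-1) ^+ k * (-1) ^+ (m - k) :> F by rewrite -exprD subnKC.
  by rewrite coef_qpochX; ring.
rewrite coef_sum (eq_big_nat _ _ coefE).
case: (leqP m n) => [le_mn | lt_nm]; last first.
  rewrite qpoch_invX_gt // !mul0r big_nat big1 // => k /= lt_kn.
  by rewrite (qbinom_gt (n - k)) ?mulr0 ?if_same //; lia.
rewrite (big_cat_nat (n := m.+1)) //= [X in _ + X]big_nat [X in _ + X]big1 ?addr0;
  last by move=> k /andP[lt_mk _]; rewrite leqNgt lt_mk.
rewrite big_mkord.
transitivity ((-1) ^+ m / Q ^+ (n * m) * qbinom Q n m
                * (Q ^+ 'C(m, 2) * qbinom Q (n + m) m)).
  rewrite -q_vandermonde mulr_sumr; apply: eq_bigr => -[k lt_km] _ /=.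
  have le_km : (k <= m)%N := lt_km; rewrite le_km expr2.
  transitivity (qbinom Q n k * (qbinom Q n k * qbinom Q (n - k) (m - k))
     * (Q ^+ 'C(k, 2) / Q ^+ (n * k)) * (-1) ^+ m * Q ^+ 'C(m - k, 2));
    first by ring.
  rewrite qbinom_trinomial // -[in Q ^+ (n * m)](subnKC le_km) mulnDr !exprD.
  by field; rewrite !expf_neq0.
rewrite qpoch_invX // /qbinom le_mn leq_addl addnK !addn1.
by field; rewrite qfact_neq0 expf_neq0.
Qed.

End Gauss.

(** * Fractions whose denominator is coprime to a polynomial *)

Section Local.
Variable P : {poly rat}.

Lemma den_coprime_poly N : den_coprime P (toQq N).
Proof. by exists N, 1; rewrite oner_neq0 coprime1p /toQq rmorph1 divr1. Qed.

Lemma den_coprime_inv D : D != 0 -> coprimep D P -> den_coprime P (toQq D)^-1.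
Proof. by exists 1, D; split=> //; rewrite /toQq rmorph1 mul1r. Qed.

Lemma den_coprimeM A B : den_coprime P A -> den_coprime P B -> den_coprime P (A * B).
Proof.
move=> [N [D [D0 cD ->]]] [N' [D' [D'0 cD' ->]]].
exists (N * N'), (D * D'); split; first by rewrite mulf_neq0.
  by rewrite coprimepMl cD.
by rewrite /toQq !rmorphM invfM /= mulrACA.
Qed.

Lemma den_coprimeD A B : den_coprime P A -> den_coprime P B -> den_coprime P (A + B).
Proof.
move=> [N [D [D0 cD ->]]] [N' [D' [D'0 cD' ->]]].
exists (N * D' + N' * D), (D * D'); split; first by rewrite mulf_neq0.
  by rewrite coprimepMl cD.
by rewrite /toQq rmorphD !rmorphM addf_div // tofrac_eq0.
Qed.

Lemma den_coprimeB A B : den_coprime P A -> den_coprime P B -> den_coprime P (A - B).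
Proof.
move=> dA dB; apply: den_coprimeD => //; rewrite -mulN1r.
apply: den_coprimeM => //; rewrite -[-1](rmorphN1 (@tofrac _)).
exact: den_coprime_poly.
Qed.

(** Congruence as divisibility by P^r inside the ring of fractions with denominator
    coprime to P, which makes compatibility with products a ring computation. *)
Lemma qcongP r A B : den_coprime P A -> den_coprime P B ->
  (exists2 C, den_coprime P C & A - B = toQq P ^+ r * C) <-> qcong P r A B.
Proof.
move=> dA dB; split=> [[C [N [D [D0 cD ->]]] eqAB]|[_ _ [N [D [D0 cD]]]]].
  split=> //; exists (P ^+ r * N), D; split=> //; first exact: dvdp_mulr.
  by rewrite eqAB /toQq rmorphM rmorphXn mulrA.
move=> /dvdpP[N' ->] eqAB; exists (toQq N' / toQq D); first by exists N', D.
by rewrite eqAB /toQq rmorphM rmorphXn /= mulrCA mulrA.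
Qed.

Lemma qcong_refl r A : den_coprime P A -> qcong P r A A.
Proof.
move=> dA; apply/qcongP => //; exists 0; last by rewrite subrr mulr0.
by rewrite -[0](rmorph0 (@tofrac _)); exact: den_coprime_poly.
Qed.

Lemma qcongM r A A' B B' : qcong P r A A' -> qcong P r B B' ->
  qcong P r (A * B) (A' * B').
Proof.
move=> cA cB; have [dA dA' _] := cA; have [dB dB' _] := cB.
apply/qcongP; try exact: den_coprimeM.
have /qcongP := cA; case=> // C dC eqA; have /qcongP := cB; case=> // D dD eqB.
exists (C * B + A' * D); first by apply: den_coprimeD; exact: den_coprimeM.
rewrite mulrDr mulrA -eqA mulrCA -eqB; ring.
Qed.

Lemma qcong_prod r (I : finType) (A B : I -> Qq) :
  (forall i, qcong P r (A i) (B i)) -> qcong P r (\prod_i A i) (\prod_i B i).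
Proof.
move=> cAB; elim/big_rec2: _ => [|i x y _ cxy]; last exact: qcongM.
by apply: qcong_refl; rewrite -[1](rmorph1 (@tofrac _)); exact: den_coprime_poly.
Qed.

End Local.

(** * The q-integer [p] *)

Lemma qint_geom p : (1 - 'X) * qint p = 1 - 'X^p.
Proof.
have := subrXX (1 : {poly rat}) 'X p; rewrite expr1n => ->; congr (_ * _).
by apply: eq_bigr => i _; rewrite expr1n mul1r.
Qed.

Lemma horner_qint1 p : (qint p).[1] = p%:R.
Proof.
rewrite horner_sum (eq_bigr (fun=> 1)) => [|i _]; last by rewrite hornerXn expr1n.
by rewrite sumr_const card_ord.
Qed.

Lemma coprimep_X_qint p : (0 < p)%N -> coprimep 'X (qint p).
Proof.
case: p => // p _; rewrite coprimep_sym coprimepX /root horner_sum big_ord_recl /=.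
rewrite hornerXn expr0 big1 ?addr0 ?oner_neq0 // => i _.
by rewrite hornerXn expr0n.
Qed.

Lemma dvdp_subX1_mul (d : {poly rat}) m k : d %| 'X^m - 1 -> d %| 'X^(m * k) - 1.
Proof.
by move=> /dvdp_trans; apply; rewrite exprM -{2}(expr1n _ k) subrXX dvdp_mulr.
Qed.

(** A common divisor divides X^m - 1 and X^p - 1, hence X - 1 because m and p are
    coprime (a Bezout relation between the exponents suffices); but X - 1 is
    coprime to [p], whose value at 1 is p. *)
Lemma coprimep_subX1_qint p m : (0 < p)%N -> (0 < m)%N -> coprime m p ->
  coprimep (1 - 'X^m) (qint p).
Proof.
move=> p_gt0 m_gt0 co_mp; apply/coprimepP => d d_m d_p.
have d_Xm : d %| 'X^m - 1 by rewrite -dvdpNr opprB.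
have d_Xp : d %| 'X^p - 1 by rewrite -dvdpNr opprB -qint_geom dvdp_mull.
have d_X1 : d %| 'X - 1%:P.
  case: (egcdnP p m_gt0) => u v uv _.
  rewrite (eqP co_mp) in uv.
  have := dvdp_subX1_mul _ _ u d_Xm; rewrite mulnC uv addn1 exprSr.
  have -> : 'X^(v * p) * 'X - 1 = 'X * ('X^(p * v) - 1) + ('X - 1%:P) :> {poly rat}.
    rewrite mulnC polyC1; ring.
  by rewrite dvdp_addr // dvdp_mull // dvdp_subX1_mul.
have : coprimep (qint p) ('X - 1%:P).
  by rewrite coprimep_XsubC /root horner_qint1 Num.Theory.pnatr_eq0 -lt0n.
by move/coprimepP; apply.
Qed.

(** * Congruence of the coefficients modulo [p]^2 *)

Lemma qvarX n : qvar ^+ n = toQq 'X^n.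
Proof. by rewrite /qvar /toQq rmorphXn. Qed.

Lemma toQq_1subXn n : toQq (1 - 'X^n) = 1 - qvar ^+ n.
Proof. by rewrite qvarX /toQq rmorphB rmorph1. Qed.

Lemma qvar_neq0 : qvar != 0.
Proof. by rewrite /qvar /toQq tofrac_eq0 polyX_eq0. Qed.

Lemma subX1_neq0 n : (0 < n)%N -> 1 - 'X^n != 0 :> {poly rat}.
Proof.
by move=> n_gt0; rewrite -oppr_eq0 opprB -size_poly_gt0 size_XnsubC.
Qed.

Lemma qvar_aperiodic n : (0 < n)%N -> qvar ^+ n != 1.
Proof.
move=> n_gt0; rewrite eq_sym -subr_eq0 -toQq_1subXn /toQq tofrac_eq0.
exact: subX1_neq0.
Qed.

(** Here z = Q^j and y = Q^n, so that q z = q^i and q y = q^p = a: this is the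
    identity (1 - q^i)^2 - (1 - q^i / a) (1 - q^i a) = (q^i / a) (1 - a)^2, with
    1 - a = (1 - q) [p]. *)
Lemma factor_diff (F : fieldType) (q y z : F) :
    1 - q != 0 -> 1 - q ^+ 2 * z != 0 -> y != 0 ->
  (1 - q * z) ^+ 2 / (1 - q ^+ 2 * z) ^+ 2
     - (1 - y^-1 * z) * (1 - q ^+ 2 * y * z) / (1 - q ^+ 2 * z) ^+ 2
  = ((1 - q * y) / (1 - q)) ^+ 2
      * (z / y * (1 - q) ^+ 2 / (1 - q ^+ 2 * z) ^+ 2).
Proof. by move=> q1 D0 y0; field; rewrite D0 y0 q1. Qed.

Lemma qcong_factor p n j : prime p -> p = n.*2.+1 -> (j.+1 < p)%N ->
  qcong (qint p) 2
    ((1 - qvar * qvar ^+ 2 ^+ j) ^+ 2 / (1 - qvar ^+ 2 * qvar ^+ 2 ^+ j) ^+ 2)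
    ((1 - (qvar ^+ 2) ^- n * qvar ^+ 2 ^+ j)
       * (1 - qvar ^+ 2 ^+ n.+1 * qvar ^+ 2 ^+ j)
       / (1 - qvar ^+ 2 * qvar ^+ 2 ^+ j) ^+ 2).
Proof.
move=> p_pr def_p lt_jp; have p_gt0 := prime_gt0 p_pr.
have dX k : den_coprime (qint p) (qvar ^+ k).
  by rewrite qvarX; exact: den_coprime_poly.
have d1X k : den_coprime (qint p) (1 - qvar ^+ k).
  by rewrite -toQq_1subXn; exact: den_coprime_poly.
have dXV k : den_coprime (qint p) (qvar ^- k).
  rewrite qvarX; apply: den_coprime_inv; first by rewrite expf_neq0 ?polyX_eq0.
  by rewrite coprimep_expl ?coprimep_X_qint.
have dD : den_coprime (qint p) ((1 - qvar ^+ 2 * qvar ^+ 2 ^+ j) ^- 2).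
  rewrite -exprS -exprM -toQq_1subXn expr2 invfM.
  have co_jp : coprime (2 * j.+1) p.
    rewrite coprime_sym prime_coprime // Euclid_dvdM // negb_or.
    rewrite !gtnNdvd // ltnNge; apply/negP => p_le2.
    by have := prime_gt1 p_pr; lia.
  by apply: den_coprimeM; apply: den_coprime_inv;
    rewrite ?subX1_neq0 ?coprimep_subX1_qint.
have dNy : den_coprime (qint p) (1 - (qvar ^+ 2) ^- n * qvar ^+ 2 ^+ j).
  by apply: den_coprimeB; [exact: (dX 0%N) | rewrite -!exprM; exact: den_coprimeM].
apply/qcongP.
- by apply: den_coprimeM => //; rewrite -exprM -exprS expr2; exact: den_coprimeM.
- apply: den_coprimeM => //; apply: den_coprimeM => //.
  by rewrite -exprD -exprM.
exists (qvar ^+ 2 ^+ j / qvar ^+ 2 ^+ n * (1 - qvar) ^+ 2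
          / (1 - qvar ^+ 2 * qvar ^+ 2 ^+ j) ^+ 2).
  apply: den_coprimeM => //; apply: den_coprimeM.
    by rewrite -!exprM; exact: den_coprimeM.
  by rewrite expr2; apply: den_coprimeM; have := d1X 1%N; rewrite expr1.
have q1 : 1 - qvar != 0 by rewrite subr_eq0 eq_sym (qvar_aperiodic 1).
have D0 : 1 - qvar ^+ 2 * qvar ^+ 2 ^+ j != 0.
  by rewrite -exprS -exprM subr_eq0 eq_sym qvar_aperiodic.
have y0 : qvar ^+ 2 ^+ n != 0 by rewrite !expf_neq0 ?qvar_neq0.
have -> : toQq (qint p) = (1 - qvar * qvar ^+ 2 ^+ n) / (1 - qvar).
  apply: (canRL (mulfK q1)); rewrite -exprM -exprS mul2n -def_p -toQq_1subXn.
  by rewrite -qint_geom /toQq rmorphM rmorphB rmorph1 mulrC.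
rewrite (exprS (qvar ^+ 2) n).
move: (qvar ^+ 2 ^+ j) (qvar ^+ 2 ^+ n) D0 y0 q1 => z y D0 y0 q1.
have := factor_diff _ _ _ _ q1 D0 y0; congr (_ = _).
Qed.

Theorem theorem2p1 (p : nat) (p_prime : prime p) (p_odd : odd p) :
  qcong_poly (qint p) 2
    (\sum_(0 <= k < p)
       (qpoch qvar (qvar ^+ 2) k ^+ 2
          / qpoch (qvar ^+ 2) (qvar ^+ 2) k ^+ 2) *: 'X^k)
    (\sum_(0 <= k < ((p - 1) %/ 2).+1)
       (qbinom (qvar ^+ 2) ((p - 1) %/ 2) k ^+ 2
          * qvar ^ (- (p%:Z * k%:Z) + k%:Z ^+ 2))
         *: ((- 'X) ^+ k * qpoch 'X ((qvar ^+ 2)%:P) ((p - 1) %/ 2 - k))).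
Proof.
set n := ((p - 1) %/ 2)%N; set Q := qvar ^+ 2.
have def_p : p = n.*2.+1.
  by have := prime_gt0 p_prime; rewrite /n divn2; have := odd_double_half p.-1; lia.
have Q_aperiodic i : (0 < i)%N -> Q ^+ i != 1.
  by move=> i_gt0; rewrite -exprM qvar_aperiodic // muln_gt0.
have Q0 : Q != 0 by rewrite expf_neq0 ?qvar_neq0.
have expE k : qvar ^ (- (p%:Z * k%:Z) + k%:Z ^+ 2) = Q ^+ 'C(k, 2) / Q ^+ (n * k).
  have -> : - (p%:Z * k%:Z) + k%:Z ^+ 2 = (2 * 'C(k, 2))%:Z - (2 * (n * k))%:Z.
    rewrite -(mul_bin_diag k 1) bin1 def_p.
    case: k => [|k] /=; first by rewrite !muln0 !mulr0.
    by rewrite expr2; lia.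
  by rewrite expfzDr ?qvar_neq0 // -!exprM -exprnN.
move=> m; rewrite [\sum_(0 <= k < n.+1) _](_ : _ = \sum_(0 <= k < n.+1)
    (qbinom Q n k ^+ 2 * (Q ^+ 'C(k, 2) / Q ^+ (n * k)))
      *: ((- 'X) ^+ k * qpoch 'X Q%:P (n - k))); last first.
  by apply: eq_bigr => k _; rewrite expE.
rewrite (coef_q_legendre _ _ Q_aperiodic) // coef_sum.
have den0 : den_coprime (qint p) 0.
  by rewrite -[0](rmorph0 (@tofrac _)); exact: den_coprime_poly.
case: (ltnP m p) => [lt_mp|le_pm]; last first.
  rewrite big_nat big1 => [|k /= lt_kp]; last first.
    by rewrite coefZ coefXn gtn_eqF ?mulr0 // (leq_trans lt_kp).
  by rewrite qpoch_invX_gt ?mul0r //; [exact: qcong_refl | lia].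
rewrite (bigD1_seq m) ?mem_index_iota ?iota_uniq //= coefZ coefXn eqxx mulr1.
rewrite big1 ?addr0 => [|k ne_km]; last first.
  by rewrite coefZ coefXn eq_sym (negbTE ne_km) mulr0.
rewrite /qpoch -!prodrXl -!big_split /= -!prodfV -!big_split /=.
apply: qcong_prod => j; apply: qcong_factor => //.
by rewrite (leq_ltn_trans _ lt_mp).
Qed.
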